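(* Let $\mathbf{M}$ be an irreducible Markov chain with finite state space $Z$, and for $a,b\in Z$ let $H(a,b)$ denote the mean hitting time from $a$ to $b$. Then for any states $a,b,c\in Z$, $$H(a,c)\leq H(a,b)+H(b,c).$$
   Context: $\mathbf{M}$ is a (time-homogeneous, discrete-time) Markov chain with finite state space $Z=\{z_1,\ldots,z_n\}$ and transition matrix $P=(p_{i,j})_{i,j=1,\ldots,n}$, which is non-negative with all row sums equal to $1$. Write $P^m=(p^{(m)}_{i,j})$. The chain is irreducible if for all $i,j$ there is $m\ge 0$ with $p^{(m)}_{i,j}>0$. For $a,b\in Z$, the hitting time $\tau_{a,b}$ is the minimal index $m\ge 0$ of a step at which the chain is in state $b$, given that the initial state (at step $0$) is $a$; in particular $\tau_{a,a}=0$. The mean hitting time is $H(a,b)=E(\tau_{a,b})=\sum_{i=0}^{\infty} i\cdot \mathrm{Probability}(\tau_{a,b}=i)$. *)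

(* Defs.v *)
From HB Require Import structures.
From mathcomp Require Import all_boot all_order all_algebra.
From mathcomp Require Import all_classical all_reals all_analysis.

Set Implicit Arguments.
Unset Strict Implicit.
Unset Printing Implicit Defensive.

Import Order.TTheory GRing.Theory Num.Theory.

Local Open Scope classical_set_scope.
Local Open Scope ring_scope.

(* Matrices over a finite state space Z are indexed by 'I_#|Z|, the state z
   having index [enum_rank z]. *)

Definition stochastic (R : realType) (n : nat) (P : 'M[R]_n) : Prop :=
  (forall i j, 0 <= P i j) /\ (forall i, \sum_j P i j = 1).

Definition irreducible (R : realType) (n : nat) (P : 'M[R]_n) : Prop :=
  forall i j : 'I_n, exists m : nat, 0 < (P ^+ m) i j.

(* Only meaningful when [B] has positive probability. *)
Definition cond_prob (R : realType) (d : measure_display)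
    (Omega : measurableType d) (mu : probability Omega R)
    (A B : set Omega) : R :=
  fine (mu (A `&` B)) / fine (mu B).

Definition history (Omega : Type) (Z : finType) (X : nat -> Omega -> Z)
    (m : nat) (x : nat -> Z) : set Omega :=
  [set w | forall k : nat, (k <= m)%N -> X k w = x k].

(* The chain is given by a process X together with, for every initial state
   a, the law [Pr a] of the chain started at a. *)
Record markov_chain (R : realType) (Z : finType) (P : 'M[R]_#|Z|)
    (d : measure_display) (Omega : measurableType d)
    (Pr : Z -> probability Omega R) (X : nat -> Omega -> Z) : Prop :=
  MarkovChain {
    mc_stochastic : stochastic P;
    mc_measurable : forall (m : nat) (z : Z), measurable [set w | X m w = z];
    mc_initial : forall a : Z, Pr a [set w | X 0%N w = a] = 1%E;
    mc_markov : forall (a : Z) (m : nat) (x : nat -> Z) (z : Z),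
      (0 < Pr a (history X m x))%E ->
      cond_prob (Pr a) [set w | X m.+1 w = z] (history X m x)
      = P (enum_rank (x m)) (enum_rank z)
  }.

(* [None] when the trajectory of w never visits b. *)
Definition hitting_time (Omega : Type) (Z : finType) (X : nat -> Omega -> Z)
    (b : Z) (w : Omega) : option nat :=
  if pselect (exists m : nat, X m w == b) is left visits
  then Some (ex_minn visits) else None.

(* The series has non-negative terms, so it always has a value in [0, +oo];
   as in the series defining the mean, trajectories that never visit b
   contribute nothing (for an irreducible chain they have probability 0). *)
Definition mean_hitting_time (R : realType) (Z : finType)
    (d : measure_display) (Omega : measurableType d)
    (Pr : Z -> probability Omega R) (X : nat -> Omega -> Z)
    (a b : Z) : \bar R :=
  (\sum_(0 <= i <oo)
     i%:R%:E * Pr a [set w | hitting_time X b w = Some i])%E.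

(* Main.v *)
Require Import Defs.
From HB Require Import structures.
From mathcomp Require Import all_boot all_order all_algebra.
From mathcomp Require Import all_classical all_reals all_analysis.
From mathcomp Require Import lra.

Set Implicit Arguments.
Unset Strict Implicit.
Unset Printing Implicit Defensive.

Import Order.TTheory GRing.Theory Num.Theory.
Import numFieldNormedType.Exports.

Local Open Scope classical_set_scope.
Local Open Scope ring_scope.

(** The infinite-horizon inequality follows from its truncated form.  Let
    u_m(i) be the probability that the chain started at i avoids j at the steps
    0, ..., m ([avoid_prob]), and S_N(i,j) the sum of u_m(i) over m < N, which
    is the expectation of the minimum of N and the hitting time
    ([truncated_mean]).  For i <> j, conditioning on the first step gives
    S_(N+1)(i,j) = 1 + sum_k p_(i,k) S_N(k,j), and from this recursion alone
    S_N(i,k) <= S_N(i,j) + S_N(j,k) follows by induction on N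
    ([truncated_mean_triangle]).

    It remains to see that H(a,b) is the supremum of the S_N(a,b).  The Markov
    property identifies the u_m with probabilities of the process
    ([avoid_probE]), and summation by parts shows that the terms of index at
    most N in the series defining H(a,b) add up to S_N(a,b) - N u_N(a).
    Hence H is at most the supremum ([mean_hitting_time_le]).  The converse
    ([truncated_mean_le]) would fail if b could be missed forever;
    irreducibility excludes this, because the limit of u_m is a subharmonic
    function vanishing at b, hence zero by the maximum principle
    ([avoid_prob_cvg0]). *)

(** * Avoidance probabilities of a stochastic matrix *)

(** First-step analysis of the event that the chain started at [i] is not in
    [j] at the steps 0, ..., [m]: the start counts, so [m.+1] positions are
    tested. *)
Fixpoint avoid_prob (R : realType) (n : nat) (P : 'M[R]_n) (j : 'I_n)
    (m : nat) (i : 'I_n) : R :=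
  if i == j then 0
  else if m is m'.+1 then \sum_k P i k * avoid_prob P j m' k else 1.

(** By summation of tails, the expectation of min([N], hitting time of [j])
    for the chain started at [i]. *)
Definition truncated_mean (R : realType) (n : nat) (P : 'M[R]_n) (i j : 'I_n)
    (N : nat) : R :=
  \sum_(m < N) avoid_prob P j m i.

Section AvoidProb.
Variables (R : realType) (n : nat) (P : 'M[R]_n) (Pst : stochastic P).
Implicit Types i j k : 'I_n.

Let P_ge0 i j : 0 <= P i j.
Proof. by case: Pst. Qed.

Let P_sum1 i : \sum_j P i j = 1.
Proof. by case: Pst. Qed.

Lemma avoid_prob_target j m : avoid_prob P j m j = 0.
Proof. by case: m => [|m] /=; rewrite eqxx. Qed.

Lemma avoid_probS j m i : i != j ->
  avoid_prob P j m.+1 i = \sum_k P i k * avoid_prob P j m k.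
Proof. by move=> /= /negbTE ->. Qed.

Lemma avoid_prob_ge0 j m i : 0 <= avoid_prob P j m i.
Proof.
elim: m i => [|m IH] i /=; case: ifP => // _.
by apply: sumr_ge0 => k _; rewrite mulr_ge0.
Qed.

Lemma avoid_prob_nonincreasing j i : nonincreasing_seq (avoid_prob P j ^~ i).
Proof.
apply/nonincreasing_seqP => m; elim: m i => [|m IH] i.
  have [->|ij] := eqVneq i j; first by rewrite !avoid_prob_target.
  rewrite avoid_probS //= (negbTE ij) -[leRHS](P_sum1 i); apply: ler_sum => k _.
  by rewrite ler_piMr ?P_ge0 //; case: ifP.
have [->|ij] := eqVneq i j; first by rewrite !avoid_prob_target.
by rewrite !avoid_probS //; apply: ler_sum => k _; rewrite ler_wpM2l.
Qed.

Lemma is_cvg_avoid_prob j i : cvgn (avoid_prob P j ^~ i).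
Proof.
apply: nonincreasing_is_cvgn; first exact: avoid_prob_nonincreasing.
by exists 0 => _ [m _ <-]; exact: avoid_prob_ge0.
Qed.

Lemma stochastic_exp m : stochastic (P ^+ m).
Proof.
elim: m => [|m [IH0 IH1]].
  split=> [i j|i]; first by rewrite expr0 mxE; case: eqP.
  rewrite expr0 (bigD1 i) //= mxE eqxx big1 ?addr0 // => j /negbTE.
  by rewrite mxE eq_sym => ->.
have PE i j : (P ^+ m.+1) i j = \sum_k P i k * (P ^+ m) k j.
  by rewrite exprS mxE.
split=> [i j|i]; first by rewrite PE; apply: sumr_ge0 => k _; rewrite mulr_ge0.
under eq_bigr do rewrite PE.
rewrite exchange_big /= -[RHS](P_sum1 i); apply: eq_bigr => k _.
by rewrite -mulr_sumr IH1 mulr1.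
Qed.

Lemma subharmonic_exp (v : 'I_n -> R) :
  (forall i, v i <= \sum_k P i k * v k) ->
  forall m i, v i <= \sum_k (P ^+ m) i k * v k.
Proof.
move=> vP; elim=> [|m IH] i.
  rewrite expr0 (bigD1 i) //= mxE eqxx mul1r big1 ?addr0 // => k /negbTE.
  by rewrite mxE eq_sym => ->; rewrite mul0r.
apply: (le_trans (vP i)).
have -> : \sum_k (P ^+ m.+1) i k * v k
          = \sum_l P i l * \sum_k (P ^+ m) l k * v k.
  under eq_bigr do rewrite exprS mxE mulr_suml.
  rewrite exchange_big /=; apply: eq_bigr => l _.
  by rewrite mulr_sumr; apply: eq_bigr => k _; rewrite mulrA.
by apply: ler_sum => l _; rewrite ler_wpM2l.
Qed.

(** Maximum principle: a maximum point [i] of [v] reaches [j] with positive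
    probability in some number [m] of steps; averaging [v] over the states at
    step [m] would lose the mass sitting at [j], where [v] vanishes, unless the
    maximum is at most 0. *)
Lemma subharmonic_le0 j (v : 'I_n -> R) : irreducible P ->
  (forall i, v i <= \sum_k P i k * v k) -> v j = 0 -> forall i, v i <= 0.
Proof.
move=> Pirr vP vj0 i0.
case: (@arg_maxP _ _ _ i0 predT v isT) => i _ imax.
apply: (le_trans (imax i0 isT)).
have [m m_gt0] := Pirr i j.
have [Pm_ge0 Pm_sum1] := stochastic_exp m.
have vi_le : v i <= (1 - (P ^+ m) i j) * v i.
  apply: (le_trans (subharmonic_exp vP m i)).
  rewrite -(Pm_sum1 i) (bigD1 j) //= vj0 mulr0 add0r.
  rewrite [X in (X - _) * _](bigD1 j) //= [X in X * _]addrC addKr mulr_suml.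
  by apply: ler_sum => k _; rewrite ler_wpM2l //; exact: imax.
by rewrite -(pmulr_rle0 _ m_gt0); lra.
Qed.

(** The limit in [m] satisfies the same first-step relation as [avoid_prob],
    so the maximum principle applies to it. *)
Lemma avoid_prob_cvg0 j i : irreducible P ->
  avoid_prob P j m i @[m --> \oo] --> 0.
Proof.
move=> Pirr; pose v k := limn (avoid_prob P j ^~ k).
have v_ge0 k : 0 <= v k.
  apply: limr_ge; first exact: is_cvg_avoid_prob.
  by apply: nearW => m; exact: avoid_prob_ge0.
have vj0 : v j = 0.
  apply: cvg_lim => //.
  by under eq_fun do rewrite avoid_prob_target; exact: cvg_cst.
have vP k : v k <= \sum_l P k l * v l.
  have [->|kj] := eqVneq k j.
    by rewrite vj0; apply: sumr_ge0 => l _; rewrite mulr_ge0.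
  have cvgS : \sum_l P k l * avoid_prob P j m l @[m --> \oo]
              --> \sum_l P k l * v l.
    apply: cvg_big => [|l _]; first exact: add_continuous.
    by apply: cvgMr; exact: is_cvg_avoid_prob.
  rewrite -(cvg_lim _ cvgS) //; apply: limr_ge; first exact: cvgP cvgS.
  apply: nearW => m; rewrite -avoid_probS //.
  exact: (nonincreasing_cvgn_ge (@avoid_prob_nonincreasing j k)
                                (@is_cvg_avoid_prob j k)).
have /le_anti <- : v i <= 0 <= v i.
  by rewrite v_ge0 (subharmonic_le0 Pirr vP vj0).
exact: is_cvg_avoid_prob.
Qed.

Lemma truncated_mean_target j N : truncated_mean P j j N = 0.
Proof. by apply: big1 => m _; exact: avoid_prob_target. Qed.

Lemma truncated_meanS i j N : i != j ->
  truncated_mean P i j N.+1 = 1 + \sum_k P i k * truncated_mean P k j N.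
Proof.
move=> ij; rewrite /truncated_mean big_ord_recl /= (negbTE ij); congr (1 + _).
under [RHS]eq_bigr do rewrite mulr_sumr.
by rewrite exchange_big.
Qed.

Lemma truncated_mean_ge0 i j N : 0 <= truncated_mean P i j N.
Proof. by apply: sumr_ge0 => m _; exact: avoid_prob_ge0. Qed.

(** Both sides satisfy a first-step relation away from [j] and [k].  The term
    with starting state [j] is constant in [i], hence unchanged by averaging
    against a row of [P], and it can only increase with the horizon. *)
Lemma truncated_mean_triangle i j k N :
  truncated_mean P i k N <= truncated_mean P i j N + truncated_mean P j k N.
Proof.
elim: N i => [|N IH] i; first by rewrite /truncated_mean !big_ord0 addr0.
have [->|ij] := eqVneq i j; first by rewrite truncated_mean_target add0r.
have [->|ik] := eqVneq i k.
  by rewrite truncated_mean_target addr_ge0 ?truncated_mean_ge0.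
rewrite (truncated_meanS _ ij) (truncated_meanS _ ik) -addrA lerD2l.
apply: (@le_trans _ _ (\sum_l P i l * truncated_mean P l j N
                       + truncated_mean P j k N)).
  rewrite -[X in _ + X]mul1r -(P_sum1 i) mulr_suml -big_split /=.
  by apply: ler_sum => l _; rewrite -mulrDr ler_wpM2l.
by rewrite lerD2l [leRHS]/truncated_mean big_ord_recr /= lerDl avoid_prob_ge0.
Qed.

End AvoidProb.

(** * The law of a Markov chain before it hits a state *)

Lemma measure_fibers (R : realType) (d : measure_display)
    (Omega : measurableType d) (mu : {measure set Omega -> \bar R})
    (Z : finType) (Y : Omega -> Z) (A : set Omega) :
  (forall z, measurable [set w | Y w = z]) -> measurable A ->
  mu A = (\sum_z mu (A `&` [set w | Y w = z]))%E.
Proof.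
move=> mY mA.
have {1}-> : A = \bigcup_(z in [set: Z]) (A `&` [set w | Y w = z]).
  rewrite -setI_bigcupr; apply/esym/setIidl => w _.
  by exists (Y w).
rewrite measure_fin_bigcup //.
- rewrite (fsbigE (index_enum Z)) ?index_enum_uniq //=.
  + by apply: eq_bigl => z; rewrite in_setT.
  + by move=> z _; rewrite mem_index_enum.
- exact: finite_finset.
- by move=> z1 z2 _ _ [w [[_ /= <-] [_ /= <-]]].
- by move=> z _; exact: measurableI.
Qed.

Section HittingLaw.
Variables (R : realType) (Z : finType) (P : 'M[R]_#|Z|).
Variables (d : measure_display) (Omega : measurableType d).
Variables (Pr : Z -> probability Omega R) (X : nat -> Omega -> Z).
Hypothesis hX : markov_chain P Pr X.

Local Notation rk := enum_rank.
Local Notation u b := (avoid_prob P (rk b)).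

(** The start [m] of the time window is a parameter because
    [history_avoids] is proved by moving it forward. *)
Definition avoids (m r : nat) (b : Z) : set Omega :=
  [set w | forall k, (k <= r)%N -> X (m + k)%N w <> b].

Lemma measurable_history m x : measurable (history X m x).
Proof.
have -> : history X m x = \bigcap_(k in [set k | (k <= m)%N])
    [set w | X k w = x k] by [].
by apply: bigcap_measurable => [|k _]; [exists 0%N|exact: mc_measurable hX _ _].
Qed.

Lemma measurable_avoids m r b : measurable (avoids m r b).
Proof.
have -> : avoids m r b = \bigcap_(k in [set k | (k <= r)%N])
    ~` [set w | X (m + k)%N w = b] by [].
apply: bigcap_measurable => [|k _]; first by exists 0%N.
by apply: measurableC; exact: mc_measurable hX _ _.
Qed.

(** The Markov property without division, which makes it meaningful for
    histories of probability zero as well. *)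
Lemma history_step a m x z :
  Pr a ([set w | X m.+1 w = z] `&` history X m x)
  = (Pr a (history X m x) * (P (rk (x m)) (rk z))%:E)%E.
Proof.
have mH := measurable_history m x.
have mXz : measurable [set w | X m.+1 w = z] by exact: mc_measurable hX _ _.
have [H0|Hgt0] := eqVneq (Pr a (history X m x)) 0%E.
  rewrite H0 mul0e; apply: (subset_measure0 _ mH _ H0).
    exact: measurableI.
  exact: subIsetr.
have {}Hgt0 : (0 < Pr a (history X m x))%E by rewrite lt0e Hgt0 measure_ge0.
have := mc_markov hX z Hgt0; rewrite /cond_prob => <-.
have finH : Pr a (history X m x) \is a fin_num by exact: fin_num_measure.
rewrite -[X in (X * _)%E](fineK finH) -EFinM mulrC divfK; last first.
  by rewrite gt_eqF // fine_gt0 //; apply/andP; split; rewrite // -ge0_fin_numE.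
by rewrite fineK //; apply: fin_num_measure; exact: measurableI.
Qed.

(** Induction on the length [r] of the window: splitting according to the
    state at step [m.+1] extends the known history by one step, and the
    transition probabilities that appear are those of the recursion defining
    [avoid_prob]. *)
Lemma history_avoids a b r m x :
  Pr a (history X m x `&` avoids m r b)
  = (Pr a (history X m x) * (u b r (rk (x m)))%:E)%E.
Proof.
have avoids0 s l y : y l = b -> Pr a (history X l y `&` avoids l s b) = 0%E.
  move=> yb; rewrite -[RHS](@measure0 _ _ _ (Pr a)); congr (Pr a _).
  rewrite -subset0 => w [/(_ l (leqnn l)) Xl /(_ 0%N isT)].
  by rewrite addn0 Xl.
elim: r m x => [|r IH] m x.
  have [xb|xb] := eqVneq (x m) b.
    by rewrite avoids0 // xb avoid_prob_target mule0.
  rewrite /= (inj_eq enum_rank_inj) (negbTE xb) mule1; congr (Pr a _).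
  apply: setIidl => w Hw k; rewrite leqn0 => /eqP ->.
  by rewrite addn0 (Hw m) //; apply/eqP.
have [xb|xb] := eqVneq (x m) b.
  by rewrite avoids0 // xb avoid_prob_target mule0.
have mH := measurable_history m x.
pose ext z k := if k == m.+1 then z else x k.
have extE z : history X m.+1 (ext z) = [set w | X m.+1 w = z] `&` history X m x.
  apply/seteqP; split=> w /=.
    move=> Hw; split=> [|k km].
      by rewrite (Hw m.+1) // /ext eqxx.
    by rewrite (Hw k) ?leqW // /ext ltn_eqF.
  move=> [Xz Hw] k; rewrite leq_eqVlt /ext; case: eqP => [->|_] //=.
  by rewrite ltnS; exact: Hw.
have splitE z : history X m x `&` avoids m r.+1 b `&` [set w | X m.+1 w = z]
    = history X m.+1 (ext z) `&` avoids m.+1 r b.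
  rewrite extE; apply/seteqP; split=> w /=.
    move=> [[Hw Aw] Xz]; split=> // k kr.
    by rewrite addSnnS; exact: Aw.
  move=> [[Xz Hw] Aw]; split=> //; split=> // -[_|k kr].
    by rewrite addn0 (Hw m) //; exact/eqP.
  by rewrite -addSnnS; exact: Aw.
transitivity (\sum_z Pr a (history X m.+1 (ext z) `&` avoids m.+1 r b))%E.
  rewrite (@measure_fibers _ _ _ _ _ (X m.+1)); last 2 first.
  - by move=> z; exact: mc_measurable hX _ _.
  - by apply: measurableI => //; exact: measurable_avoids.
  by apply: eq_bigr => z _; rewrite splitE.
under eq_bigr => z _ do rewrite IH extE history_step /ext eqxx.
rewrite -(fineK (fin_num_measure (Pr a) _ mH)).
under eq_bigr do rewrite -!EFinM -mulrA.
rewrite sumEFin -mulr_sumr avoid_probS; last by rewrite (inj_eq enum_rank_inj).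
rewrite -EFinM; congr (_ * _)%:E.
rewrite [RHS](reindex (@enum_rank Z)) //.
by apply: onW_bij; exact: enum_rank_bij.
Qed.

Lemma avoid_probE a b r : Pr a (avoids 0 r b) = (u b r (rk a))%:E.
Proof.
have histE : history X 0 (fun=> a) = [set w | X 0%N w = a].
  apply/seteqP; split=> w /=; first by move=> /(_ 0%N); apply.
  by move=> Xa k; rewrite leqn0 => /eqP ->.
have mX0 : measurable [set w | X 0%N w = a] by exact: mc_measurable hX _ _.
have mA := measurable_avoids 0 r b.
have := history_avoids a b r 0 (fun=> a).
rewrite histE (mc_initial hX) mul1e => <-.
have /eqP X0 : Pr a (~` [set w | X 0%N w = a]) == 0%E.
  by rewrite probability_setC // (mc_initial hX) subee.
have mD : measurable (avoids 0 r b `\` [set w | X 0%N w = a]).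
  exact: measurableD.
rewrite (measureDI (Pr a) mA mX0) setIC [X in (X + _)%E](_ : _ = 0%E) ?add0e //.
by apply: (subset_measure0 mD (measurableC mX0) _ X0) => w [].
Qed.

Lemma hitting_timeS b i :
  [set w | hitting_time X b w = Some i.+1] = avoids 0 i b `\` avoids 0 i.+1 b.
Proof.
rewrite /hitting_time; apply/seteqP; split=> w /=.
  case: pselect => // visits [].
  case: ex_minnP => m /eqP Xm mmin ?; subst m.
  split=> [k ki Xk|/(_ i.+1 (leqnn _))]; last by rewrite add0n Xm.
  have := mmin k; rewrite -[k]add0n Xk eqxx => /(_ isT).
  by rewrite add0n ltnNge ki.
move=> [avi /existsNP[k /not_implyP[ki /contrapT Xk]]].
have {ki} kE : k = i.+1.
  apply/eqP; rewrite eqn_leq ki /= ltnNge; apply/negP => /avi.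
  by rewrite Xk.
rewrite add0n kE in Xk; case: pselect => [visits|[]]; last first.
  by exists i.+1; exact/eqP.
case: ex_minnP => m /eqP Xm mmin; congr Some; apply/eqP.
rewrite eqn_leq mmin ?Xk ?eqxx //= ltnNge; apply/negP => /avi.
by rewrite add0n Xm.
Qed.

Lemma hitting_timeS_prob a b i :
  Pr a [set w | hitting_time X b w = Some i.+1]
  = (u b i (rk a) - u b i.+1 (rk a))%:E.
Proof.
have mA r := measurable_avoids 0 r b.
have : (Pr a (avoids 0 i b) = Pr a (avoids 0 i b `\` avoids 0 i.+1 b)
    + Pr a (avoids 0 i b `&` avoids 0 i.+1 b))%E by exact: measureDI.
have -> : avoids 0 i b `&` avoids 0 i.+1 b = avoids 0 i.+1 b.
  by apply: setIidr => w Aw k ki; apply: Aw; exact: leqW.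
rewrite !avoid_probE hitting_timeS EFinB => ->.
by rewrite addeK.
Qed.

(** Summation by parts, the probability of hitting exactly at step [i.+1]
    being u_i - u_(i+1). *)
Lemma mean_hitting_time_partial a b N :
  (\sum_(0 <= i < N.+1) i%:R%:E * Pr a [set w | hitting_time X b w = Some i])%E
  = (truncated_mean P (rk a) (rk b) N - N%:R * u b N (rk a))%:E.
Proof.
elim: N => [|N IH].
  by rewrite big_nat1 mul0e /truncated_mean big_ord0 mul0r subr0.
rewrite big_nat_recr //= IH hitting_timeS_prob -EFinM -EFinD.
rewrite /truncated_mean big_ord_recr -natr1; congr EFin.
rewrite /=; lra.
Qed.

Let terms_ge0 a b (i : nat) :
  (0 <= i%:R%:E * Pr a [set w | hitting_time X b w = Some i])%E.
Proof. by rewrite mule_ge0 // lee_fin. Qed.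

Lemma mean_hitting_time_le a b (y : \bar R) :
  (forall N, ((truncated_mean P (rk a) (rk b) N)%:E <= y)%E) ->
  (mean_hitting_time Pr X a b <= y)%E.
Proof.
move=> le_y; apply: lime_le; first exact: is_cvg_nneseries.
exists 1%N => //= -[//|N] _.
rewrite mean_hitting_time_partial; apply: le_trans (le_y N).
rewrite lee_fin gerBl mulr_ge0 //; apply: avoid_prob_ge0.
exact: mc_stochastic hX.
Qed.

(** Fix [M].  A partial sum of order [N >= M] is at least S_M - M u_N, since
    the avoidance probabilities between [M] and [N] are at least u_N; then let
    [N] tend to infinity, so that M u_N tends to 0. *)
Lemma truncated_mean_le a b M : irreducible P ->
  ((truncated_mean P (rk a) (rk b) M)%:E <= mean_hitting_time Pr X a b)%E.
Proof.
move=> Pirr; have Pst := mc_stochastic hX.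
have H_ge0 : (0 <= mean_hitting_time Pr X a b)%E.
  by apply: nneseries_ge0 => i _ _; exact: terms_ge0.
have partial_le N : (M <= N)%N ->
    ((truncated_mean P (rk a) (rk b) M - M%:R * u b N (rk a))%:E
     <= mean_hitting_time Pr X a b)%E.
  move=> MN.
  have : (\sum_(0 <= i < N.+1)
      i%:R%:E * Pr a [set w | hitting_time X b w = Some i]
      <= mean_hitting_time Pr X a b)%E.
    by apply: nneseries_lim_ge => i _ _; exact: terms_ge0.
  rewrite mean_hitting_time_partial; apply: le_trans; rewrite lee_fin.
  rewrite -(subnKC MN) /truncated_mean big_split_ord /= natrD mulrDl.
  rewrite opprD addrACA lerDl subr_ge0.
  rewrite -[X in X%:R]card_ord mulr_natl -sumr_const; apply: ler_sum => r _.
  by apply: avoid_prob_nonincreasing; rewrite ?leq_add2l // ltnW.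
case: (mean_hitting_time Pr X a b) H_ge0 partial_le => [h|_ _|//]; last first.
  by rewrite leey.
move=> _ le_h; rewrite lee_fin.
have cvgM : truncated_mean P (rk a) (rk b) M - M%:R * u b N (rk a) @[N --> \oo]
            --> truncated_mean P (rk a) (rk b) M.
  rewrite -[X in _ --> X]subr0 -[X in _ --> _ - X](mulr0 M%:R).
  by apply: cvgB; [exact: cvg_cst|apply: cvgMr; exact: avoid_prob_cvg0].
rewrite -(cvg_lim _ cvgM) //; apply: limr_le; first exact: cvgP cvgM.
by exists M => // N /= MN; rewrite -lee_fin; exact: le_h.
Qed.

End HittingLaw.

(** * The triangle inequality *)

Theorem theorem1 (R : realType) (Z : finType) (P : 'M[R]_#|Z|)
    (d : measure_display) (Omega : measurableType d)
    (Pr : Z -> probability Omega R) (X : nat -> Omega -> Z)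
    (hX : markov_chain P Pr X) (hirr : irreducible P) (a b c : Z) :
  (mean_hitting_time Pr X a c
   <= mean_hitting_time Pr X a b + mean_hitting_time Pr X b c)%E.
Proof.
apply: (mean_hitting_time_le hX) => N.
apply: (@le_trans _ _ (truncated_mean P (enum_rank a) (enum_rank b) N
                       + truncated_mean P (enum_rank b) (enum_rank c) N)%:E).
  by rewrite lee_fin; apply: truncated_mean_triangle; exact: mc_stochastic hX.
by rewrite EFinD leeD // (truncated_mean_le hX).
Qed.
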